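(* Let $k$ be a field, $r\geq 1$, and let $\hat H$ be a complete $k$-algebra augmented over $k^r$. Let $A$ be a $k$-algebra, let $\{M_i\}_{i=1}^r$ be a family of simple right $A$-modules each having a countable $k$-basis, put $M=\bigoplus_{i=1}^r M_i$, and suppose there is a homomorphism $\rho_A:A\to\hat O(M):=\operatorname{End}_{\hat H}(\hat H\hat\otimes_{k^r}M)$. Then $\hat O(M)$ is $r$-pointed, and $M_1,\dots,M_r$ are contained in the set of simple right $\hat O(M)$-modules.
   Context: All $k$-algebras are associative and unital with $k$ in the center; ''countable'' means finite or countably infinite. A $k$-algebra $H$ is augmented over $k^r$ if it comes with $k$-algebra homomorphisms $\rho:k^r\to H$ and $\pi:H\to k^r$ with $\pi\circ\rho=\mathrm{id}_{k^r}$. Put $\mathfrak m=\ker\pi$. Such an algebra is complete if the natural map $H\to\varprojlim_n H/\mathfrak m^n$ is an isomorphism. A ring is $r$-pointed if it has exactly $r$ maximal two-sided ideals. $M=\bigoplus_i M_i$ is a $k^r$-module, the $i$-th standard idempotent of $k^r$ acting as the projection onto $M_i$, and $\hat H\hat\otimes_{k^r}M=\varprojlim_n\,(\hat H/\mathfrak m^n)\otimes_{k^r}M$ is the completed tensor product, a left $\hat H$-module with the inverse limit topology. $\operatorname{End}_{\hat H}$ denotes the ring of continuous left $\hat H$-linear endomorphisms. Endomorphism rings are composed in the order $(fg)(x)=g(f(x))$, so that $M_i$ is a right $\operatorname{End}_k(M_i)$-module and right multiplication $a\mapsto(m\mapsto ma)$ is a ring homomorphism $A\to\operatorname{End}_k(M_i)$.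 Reduction along $\pi:\hat H\to k^r$ gives a homomorphism $\hat O(M)\to\operatorname{End}_{k^r}(M)=\bigoplus_{i=1}^r\operatorname{End}_k(M_i)$, and $M_i$ is regarded as a right $\hat O(M)$-module through this homomorphism followed by projection to $\operatorname{End}_k(M_i)$. *)

(* Defs.v *)
From HB Require Import structures.
From mathcomp Require Import all_boot all_order all_algebra.
From mathcomp Require Import all_classical topology.
From mathcomp Require Import freeg.

Set Implicit Arguments.
Unset Strict Implicit.
Unset Printing Implicit Defensive.
Import GRing.Theory.
Local Open Scope classical_set_scope.
Local Open Scope ring_scope.
Local Open Scope quotient_scope.

(* A right module over a ring R is a left module over the converse ring R^c,
   i.e. an [lmodType R^c], where [(a : R^c) *: v] is v a. *)

Section AddSpan.
Variable V : zmodType.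

Definition subgroup (G : set V) : Prop :=
  G 0 /\ forall x y, G x -> G y -> G (x - y).

Definition addspan (S : set V) : {pred V} :=
  fun x => `[< forall G : set V, subgroup G -> S `<=` G -> G x >].

Lemma addspanP (S : set V) (x : V) :
  reflect (forall G : set V, subgroup G -> S `<=` G -> G x) (x \in addspan S).
Proof. exact: asboolP. Qed.

Fact addspan_zmod_closed (S : set V) : zmod_closed (addspan S).
Proof.
split; first by apply/addspanP => G [].
move=> x y /addspanP hx /addspanP hy; apply/addspanP => G gG sG.
by apply: gG.2; [exact: hx | exact: hy].
Qed.

HB.instance Definition _ (S : set V) :=
  GRing.isZmodClosed.Build V (addspan S) (addspan_zmod_closed S).

Lemma addspan_sub (S : set V) (x : V) : S x -> x \in addspan S.
Proof. by move=> Sx; apply/addspanP => G _; apply. Qed.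

Lemma subgroup_pred (P : zmodClosed V) : subgroup [set x | x \in P].
Proof. by split=> [|x y]; [exact: rpred0 | exact: rpredB]. Qed.

Lemma subgroup_ker (W : zmodType) (f : V -> W) :
  {morph f : x y / x + y} -> subgroup [set x | f x = 0].
Proof.
move=> fD; have f0 : f 0 = 0.
  by apply: (addrI (f 0)); rewrite -fD !addr0.
have fN x : f (- x) = - f x.
  by apply: (addrI (f x)); rewrite -fD !subrr.
by split=> //= x y fx fy; rewrite fD fN fx fy subrr.
Qed.

End AddSpan.

Section Quot.
Variables (V : zmodType) (I : zmodClosed V).
Local Notation Q := (Quotient.quot I).

Lemma quot_piD : {morph \pi_Q : x y / x + y}.
Proof. by move=> x y; rewrite piE. Qed.

Lemma quot_pi0 : \pi_Q 0 = 0.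
Proof. by apply: (addrI (\pi_Q 0)); rewrite -quot_piD !addr0. Qed.

Lemma quot_piN : {morph \pi_Q : x / - x}.
Proof. by move=> x; apply: (addrI (\pi_Q x)); rewrite -quot_piD !subrr quot_pi0. Qed.

Lemma quot_pi_eq x y : x - y \in I -> \pi_Q x = \pi_Q y.
Proof. by move=> h; apply/eqP; rewrite -Quotient.idealrBE. Qed.

Lemma quot_repr x : repr (\pi_Q x) - x \in I.
Proof. by rewrite Quotient.idealrBE reprK. Qed.

End Quot.

Section Tensor.
Variables (R : pzRingType) (X : zmodType) (ra : X -> R -> X) (Y : lmodType R).

(* The tensor product over R of the right R-module X, whose action is [ra],
   and the left R-module Y: the free abelian group on X * Y modulo the usual
   relations. *)
Definition tensor_rel : set {freeg (X * Y)} := [set z |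
  [\/ exists x x' y, z = << (x + x', y) >> - << (x, y) >> - << (x', y) >>,
      exists x y y', z = << (x, y + y') >> - << (x, y) >> - << (x, y') >>
    | exists x c y, z = << (ra x c, y) >> - << (x, c *: y) >>]].

Definition tensor : Type := Quotient.quot (addspan tensor_rel).
HB.instance Definition _ := GRing.Zmodule.on tensor.

Definition tens (x : X) (y : Y) : tensor :=
  \pi_(Quotient.quot (addspan tensor_rel)) << (x, y) >>.

Definition balanced (Z : zmodType) (b : X -> Y -> Z) : Prop :=
  [/\ forall y, {morph b^~ y : x x' / x + x'},
      forall x, {morph b x : y y' / y + y'}
    & forall x c y, b (ra x c) y = b x (c *: y)].

(* The additive map x (x) y |-> b x y, meaningful when b is balanced. *)
Definition tlift (Z : zmodType) (b : X -> Y -> Z) (t : tensor) : Z :=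
  fglift (fun xy : X * Y => b xy.1 xy.2 : zmodule Z)
    (repr (t : Quotient.quot (addspan tensor_rel))).

Lemma tens_balanced : balanced tens.
Proof.
have E a b c : a - b - c \in addspan tensor_rel ->
    \pi_(Quotient.quot (addspan tensor_rel)) a = \pi b + \pi c.
  by move=> h; rewrite -quot_piD; apply: quot_pi_eq; rewrite opprD addrA.
split=> [y x x'|x y y'|x c y].
- by apply: E; apply: addspan_sub; apply: Or31; exists x, x', y.
- by apply: E; apply: addspan_sub; apply: Or32; exists x, y, y'.
- by apply: quot_pi_eq; apply: addspan_sub; apply: Or33; exists x, c, y.
Qed.

Section Lift.
Variables (Z : zmodType) (b : X -> Y -> Z) (bb : balanced b).
Let F : {freeg (X * Y)} -> zmodule Z :=
  fglift (fun xy : X * Y => b xy.1 xy.2 : zmodule Z).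

Let FU xy : F << xy >> = b xy.1 xy.2.
Proof. by rewrite /F liftU scale1r. Qed.

Let FB : {morph F : x y / x - y}.
Proof. exact: lift_is_additive. Qed.

Let FD : {morph F : x y / x + y}.
Proof.
have F0 : F 0 = 0 by rewrite -[0 in LHS](subrr 0) FB subrr.
by move=> x y; rewrite -[y in LHS]opprK FB -[- y]sub0r FB F0 sub0r opprK.
Qed.

Let F_rel x : x \in addspan tensor_rel -> F x = 0.
Proof.
move=> /addspanP /(_ [set z | F z = 0]); apply; first exact: subgroup_ker FD.
case: bb => b1 b2 b3 z [[x1 [x2 [y ->]]]|[x1 [y1 [y2 ->]]]|[x1 [c [y ->]]]] /=.
- by rewrite !FB !FU /= b1 addrAC addrK subrr.
- by rewrite !FB !FU /= b2 addrAC addrK subrr.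
- by rewrite !FB !FU /= b3 subrr.
Qed.

Let F_pi x : F (repr (\pi_(Quotient.quot (addspan tensor_rel)) x)) = F x.
Proof.
apply/subr0_eq; rewrite -FB; apply: F_rel.
exact: (@quot_repr _ (addspan tensor_rel)).
Qed.

Lemma tlift_tens x y : tlift b (tens x y) = b x y.
Proof. by rewrite [LHS]F_pi FU. Qed.

Lemma tliftD : {morph tlift b : s t / s + t}.
Proof.
have E u : tlift b (\pi_(Quotient.quot (addspan tensor_rel)) u) = F u.
  exact: F_pi.
move=> s t; rewrite -[s](@reprK _ (Quotient.quot (addspan tensor_rel))).
rewrite -[t](@reprK _ (Quotient.quot (addspan tensor_rel))).
by rewrite [LHS](congr1 (tlift b) (esym (quot_piD _ _ _))) !E FD.
Qed.

End Lift.

Lemma tensor_ind (P : set tensor) :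
  subgroup P -> (forall x y, P (tens x y)) -> forall t, P t.
Proof.
move=> [P0 PB] Pt t; rewrite -[t](@reprK _ (Quotient.quot (addspan tensor_rel))).
set D := repr _; rewrite -(freeg_sumE D).
have PN u : P u -> P (- u) by move=> h; rewrite -[- u]add0r; apply: PB.
have PD u v : P u -> P v -> P (u + v).
  by move=> hu hv; rewrite -[v]opprK; apply: PB => //; apply: PN.
have pi0 := quot_pi0 (addspan tensor_rel).
move: (freeg.dom D) => s; elim: s => [|z s IH]; first by rewrite big_nil pi0; exact: P0.
rewrite big_cons quot_piD; apply: (PD); last exact: IH.
have PU n : P (\pi_(Quotient.quot (addspan tensor_rel)) << n%:Z *g z >>).
  elim: n => [|n IHn]; first by rewrite freegU0 pi0; exact: P0.
  rewrite -addn1 PoszD -freegUD quot_piD; apply: (PD); first exact: IHn.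
  by case: z {IH IHn} => x y; exact: Pt.
case: (coeff z D) => n; first exact: PU.
rewrite NegzE -freegUN.
rewrite quot_piN; apply: (PN); exact: PU.
Qed.

Lemma tensor_ext (Z : zmodType) (f g : tensor -> Z) :
  {morph f : s t / s + t} -> {morph g : s t / s + t} ->
  (forall x y, f (tens x y) = g (tens x y)) -> f =1 g.
Proof.
move=> fD gD fg t; apply/subr0_eq; move: t; apply: tensor_ind.
  apply: (@subgroup_ker _ _ (fun t => f t - g t)) => s t.
  by rewrite fD gD opprD addrACA.
by move=> x y /=; rewrite fg subrr.
Qed.

End Tensor.

Section InverseLimit.
Variables (R : pzRingType) (T : nat -> lmodType R).
Variable p : forall n, {linear T n.+1 -> T n}.

Record invlim : Type := InvLim {
  coord :> forall n, T n;
  coordP : forall n, p n (coord n.+1) = coord n }.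

Lemma invlim_ext (x y : invlim) : (forall n, x n = y n) -> x = y.
Proof.
case: x y => [x xP] [y yP] /= xy.
have E : x = y by apply: functional_extensionality_dep.
by subst y; congr InvLim; exact: Prop_irrelevance.
Qed.

HB.instance Definition _ := gen_eqMixin invlim.
HB.instance Definition _ := gen_choiceMixin invlim.

Definition invlim0 : invlim := InvLim (fun n => linear0 (p n)).

Fact invlim_addP (x y : invlim) n : p n (x n.+1 + y n.+1) = x n + y n.
Proof. by rewrite linearD !coordP. Qed.
Definition invlim_add (x y : invlim) : invlim := InvLim (invlim_addP x y).

Fact invlim_oppP (x : invlim) n : p n (- x n.+1) = - x n.
Proof. by rewrite linearN coordP. Qed.
Definition invlim_opp (x : invlim) : invlim := InvLim (invlim_oppP x).

Fact invlim_scaleP (a : R) (x : invlim) n : p n (a *: x n.+1) = a *: x n.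
Proof. by rewrite linearZ coordP. Qed.
Definition invlim_scale (a : R) (x : invlim) : invlim :=
  InvLim (invlim_scaleP a x).

Fact invlim_addA : associative invlim_add.
Proof. by move=> x y z; apply: invlim_ext => n /=; rewrite addrA. Qed.
Fact invlim_addC : commutative invlim_add.
Proof. by move=> x y; apply: invlim_ext => n /=; rewrite addrC. Qed.
Fact invlim_add0 : left_id invlim0 invlim_add.
Proof. by move=> x; apply: invlim_ext => n /=; rewrite add0r. Qed.
Fact invlim_addN : left_inverse invlim0 invlim_opp invlim_add.
Proof. by move=> x; apply: invlim_ext => n /=; rewrite addNr. Qed.

HB.instance Definition _ := GRing.isZmodule.Build invlim
  invlim_addA invlim_addC invlim_add0 invlim_addN.

Fact invlim_scaleA a b x :
  invlim_scale a (invlim_scale b x) = invlim_scale (a * b) x.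
Proof. by apply: invlim_ext => n /=; rewrite scalerA. Qed.
Fact invlim_scale1 : left_id 1 invlim_scale.
Proof. by move=> x; apply: invlim_ext => n /=; rewrite scale1r. Qed.
Fact invlim_scaleDr : right_distributive invlim_scale +%R.
Proof. by move=> a x y; apply: invlim_ext => n /=; rewrite scalerDr. Qed.
Fact invlim_scaleDl x : {morph invlim_scale^~ x : a b / a + b}.
Proof. by move=> a b; apply: invlim_ext => n /=; rewrite scalerDl. Qed.

HB.instance Definition _ := GRing.Zmodule_isLmodule.Build R invlim
  invlim_scaleA invlim_scale1 invlim_scaleDr invlim_scaleDl.

Lemma coordD (x y : invlim) n : (x + y) n = x n + y n. Proof. by []. Qed.
Lemma coordN (x : invlim) n : (- x) n = - x n. Proof. by []. Qed.
Lemma coordZ a (x : invlim) n : (a *: x) n = a *: x n. Proof. by []. Qed.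
Lemma coord0 n : (0 : invlim) n = 0. Proof. by []. Qed.

(* The inverse limit topology: the subspace topology of the product of the
   discrete modules T n. *)
HB.instance Definition _ := Topological.copy invlim
  (initial_topology
     (coord : invlim -> prod_topology (fun n => discrete_topology (T n)))).

Lemma coord_le (x y : invlim) m n : (m <= n)%N -> x n = y n -> x m = y m.
Proof.
move=> /subnK <-; elim: (n - m)%N => [//|d IH] h; apply: IH.
by rewrite -(coordP x) -(coordP y); exact: congr1 h.
Qed.

Lemma nbhs_invlimP (x : invlim) (A : set invlim) :
  nbhs x A <-> exists N, forall y : invlim, y N = x N -> A y.
Proof.
pose P := prod_topology (fun n => discrete_topology (T n)).
pose F := filter_from [set: nat] (fun N => [set y : invlim | y N = x N]).
have FF : Filter F.
  apply: filter_from_filter; first by exists 0%N.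
  move=> i j _ _; exists (maxn i j) => // y /= h.
  by split; apply: coord_le h; [exact: leq_maxl | exact: leq_maxr].
split.
- case=> B [[C oC <-] Cx] CA.
  suff : (coord @ F) C by case=> N _ h; exists N => y /h /CA.
  have : (coord : invlim -> P) @ F --> (coord x : P).
    apply/cvg_sup => i D [_ [[E oE <-] Ex]] ED.
    by exists i => // y /= yx; apply: ED; rewrite /= yx.
  by apply; exact: open_nbhs_nbhs.
- case=> N h; have : nbhs (x N : discrete_topology (T N)) [set x N].
    exact: discrete_set1.
  move=> /(@proj_continuous _ (fun n => discrete_topology (T n)) N (coord x)).
  move=> /(@initial_continuous _ P coord x) nx.
  apply: (@filterS invlim (nbhs x) _ _ _ _ nx) => y; exact: h.
Qed.

Lemma continuous_invlimP (f : invlim -> invlim) :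
  continuous f <-> forall (x : invlim) n, exists N, forall y : invlim,
    y N = x N -> f y n = f x n.
Proof.
split=> [cf x n|cf x A].
  have /cf /nbhs_invlimP [N h] : nbhs (f x) [set z : invlim | z n = f x n].
    by apply/nbhs_invlimP; exists n.
  by exists N.
move=> /nbhs_invlimP [n h]; have [N hN] := cf x n.
by apply/nbhs_invlimP; exists N => y /hN /h.
Qed.

(* Continuous R-linear endomorphisms; the product is in the order
   (f * g) x = g (f x). *)
Record contEnd : Type := ContEnd {
  cfun :> invlim -> invlim;
  cfun_linear : linear cfun;
  cfun_continuous : continuous cfun }.

Lemma contEnd_ext (f g : contEnd) : f =1 g -> f = g.
Proof.
case: f g => [f fl fc] [g gl gc] /= /funext fg; subst g.
by congr ContEnd; exact: Prop_irrelevance.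
Qed.

HB.instance Definition _ := gen_eqMixin contEnd.
HB.instance Definition _ := gen_choiceMixin contEnd.
HB.instance Definition _ (f : contEnd) :=
  GRing.isLinear.Build R invlim invlim *:%R (cfun f) (@cfun_linear f).

Fact contEnd0_linear : linear (fun _ : invlim => 0 : invlim).
Proof. by move=> a x y; rewrite scaler0 addr0. Qed.
Fact contEnd0_continuous : continuous (fun _ : invlim => 0 : invlim).
Proof. by apply/continuous_invlimP => x n; exists 0%N. Qed.
Definition contEnd0 := ContEnd contEnd0_linear contEnd0_continuous.

Fact contEnd_add_linear (f g : contEnd) : linear (fun x : invlim => f x + g x).
Proof. by move=> a x y; rewrite !linearP scalerDr addrACA. Qed.
Fact contEnd_add_continuous (f g : contEnd) : continuous (fun x : invlim => f x + g x).
Proof.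
apply/continuous_invlimP => x n.
have [Nf hf] := (continuous_invlimP f).1 (@cfun_continuous f) x n.
have [Ng hg] := (continuous_invlimP g).1 (@cfun_continuous g) x n.
exists (maxn Nf Ng) => y h; rewrite !coordD hf ?hg //.
  by apply: coord_le h; exact: leq_maxr.
by apply: coord_le h; exact: leq_maxl.
Qed.
Definition contEnd_add f g :=
  ContEnd (@contEnd_add_linear f g) (@contEnd_add_continuous f g).

Fact contEnd_opp_linear (f : contEnd) : linear (fun x : invlim => - f x).
Proof. by move=> a x y; rewrite linearP opprD scalerN. Qed.
Fact contEnd_opp_continuous (f : contEnd) : continuous (fun x : invlim => - f x).
Proof.
apply/continuous_invlimP => x n.
have [N h] := (continuous_invlimP f).1 (@cfun_continuous f) x n.
by exists N => y /h; rewrite !coordN => ->.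
Qed.
Definition contEnd_opp f :=
  ContEnd (@contEnd_opp_linear f) (@contEnd_opp_continuous f).

Fact contEnd1_linear : linear (@id invlim).
Proof. by []. Qed.
Fact contEnd1_continuous : continuous (@id invlim).
Proof. by move=> x; exact: cvg_id. Qed.
Definition contEnd1 := ContEnd contEnd1_linear contEnd1_continuous.

Fact contEnd_mul_linear (f g : contEnd) : linear (fun x : invlim => g (f x)).
Proof. by move=> a x y; rewrite !linearP. Qed.
Fact contEnd_mul_continuous (f g : contEnd) : continuous (fun x : invlim => g (f x)).
Proof.
by move=> x; apply: (@continuous_comp _ _ _ f g); exact: cfun_continuous.
Qed.
Definition contEnd_mul f g :=
  ContEnd (@contEnd_mul_linear f g) (@contEnd_mul_continuous f g).

Fact contEnd_addA : associative contEnd_add.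
Proof. by move=> f g h; apply: contEnd_ext => x /=; rewrite addrA. Qed.
Fact contEnd_addC : commutative contEnd_add.
Proof. by move=> f g; apply: contEnd_ext => x /=; rewrite addrC. Qed.
Fact contEnd_addz : left_id contEnd0 contEnd_add.
Proof. by move=> f; apply: contEnd_ext => x /=; rewrite add0r. Qed.
Fact contEnd_addN : left_inverse contEnd0 contEnd_opp contEnd_add.
Proof. by move=> f; apply: contEnd_ext => x /=; rewrite addNr. Qed.

HB.instance Definition _ := GRing.isZmodule.Build contEnd
  contEnd_addA contEnd_addC contEnd_addz contEnd_addN.

Fact contEnd_mulA : associative contEnd_mul.
Proof. by move=> f g h; exact: contEnd_ext. Qed.
Fact contEnd_mul1l : left_id contEnd1 contEnd_mul.
Proof. by move=> f; exact: contEnd_ext. Qed.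
Fact contEnd_mul1r : right_id contEnd1 contEnd_mul.
Proof. by move=> f; exact: contEnd_ext. Qed.
Fact contEnd_mulDl : left_distributive contEnd_mul +%R.
Proof. by move=> f g h; apply: contEnd_ext => x /=; rewrite linearD. Qed.
Fact contEnd_mulDr : right_distributive contEnd_mul +%R.
Proof. by move=> f g h; exact: contEnd_ext. Qed.

HB.instance Definition _ := GRing.Zmodule_isPzRing.Build contEnd
  contEnd_mulA contEnd_mul1l contEnd_mul1r contEnd_mulDl contEnd_mulDr.

End InverseLimit.

Section ContEndAlgebra.
Variables (k : fieldType) (R : algType k) (T : nat -> lmodType R).
Variable p : forall n, {linear T n.+1 -> T n}.
Local Notation E := (contEnd p).

Fact contEnd_scale_linear (c : k) (f : E) :
  linear (fun x : invlim p => (c%:A : R) *: f x).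
Proof.
move=> a x y; rewrite linearP scalerDr !scalerA.
by rewrite -!scalerAl -!scalerAr mul1r mulr1.
Qed.
Fact contEnd_scale_continuous (c : k) (f : E) :
  continuous (fun x : invlim p => (c%:A : R) *: f x).
Proof.
apply/continuous_invlimP => x n.
have [N h] := (continuous_invlimP f).1 (@cfun_continuous _ _ _ f) x n.
by exists N => y /h; rewrite !coordZ => ->.
Qed.
Definition contEnd_scale c f : E :=
  ContEnd (@contEnd_scale_linear c f) (@contEnd_scale_continuous c f).

Fact contEnd_scaleA a b f :
  contEnd_scale a (contEnd_scale b f) = contEnd_scale (a * b) f.
Proof.
by apply: contEnd_ext => x /=; rewrite scalerA -scalerAl mul1r scalerA.
Qed.
Fact contEnd_scale1 : left_id 1 contEnd_scale.
Proof. by move=> f; apply: contEnd_ext => x /=; rewrite !scale1r. Qed.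
Fact contEnd_scaleDr : right_distributive contEnd_scale +%R.
Proof. by move=> a f g; apply: contEnd_ext => x /=; rewrite scalerDr. Qed.
Fact contEnd_scaleDl f : {morph contEnd_scale^~ f : a b / a + b}.
Proof. by move=> a b; apply: contEnd_ext => x /=; rewrite !scalerDl. Qed.

HB.instance Definition _ := GRing.Zmodule_isLmodule.Build k E
  contEnd_scaleA contEnd_scale1 contEnd_scaleDr contEnd_scaleDl.

(* Together with the ring structure, [E] is a k-algebra; it is not declared an
   [algType k] because that would require it to be nonzero. *)
Lemma contEnd_scaleAl c (f g : E) : c *: (f * g) = (c *: f) * g.
Proof. by apply: contEnd_ext => x /=; rewrite linearZ. Qed.
Lemma contEnd_scaleAr c (f g : E) : c *: (f * g) = f * (c *: g).
Proof. exact: contEnd_ext. Qed.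

End ContEndAlgebra.

Section Ideals.
Variable R : pzRingType.

Definition two_sided_ideal (J : set R) : Prop :=
  [/\ subgroup J, forall a x, J x -> J (a * x)
    & forall a x, J x -> J (x * a)].

Definition maximal_ideal (J : set R) : Prop :=
  [/\ two_sided_ideal J, J <> setT
    & forall K, two_sided_ideal K -> J `<=` K -> K = J \/ K = setT].

Definition pointed (r : nat) : Prop :=
  ([set J : set R | maximal_ideal J] #= `I_r)%card.

Fixpoint ideal_pow (I : set R) (n : nat) : {pred R} :=
  if n is n'.+1 then
    addspan [set z | exists a b, [/\ I a, b \in ideal_pow I n' & z = a * b]]
  else predT.

Fact ideal_pow_zmod_closed I n : zmod_closed (ideal_pow I n).
Proof. by case: n => [|n]; [split | exact: addspan_zmod_closed]. Qed.

HB.instance Definition _ I n :=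
  GRing.isZmodClosed.Build R (ideal_pow I n) (ideal_pow_zmod_closed I n).

Lemma ideal_pow_ideal (I : set R) n : two_sided_ideal I ->
  two_sided_ideal [set x | x \in ideal_pow I n].
Proof.
move=> [_ Il _]; elim: n => [|n [_ IHl IHr]]; first by [].
split; first exact: subgroup_pred.
- move=> a x /= /addspanP /(_ [set z | a * z \in ideal_pow I n.+1]); apply.
    split; first by rewrite /= mulr0 rpred0.
    by move=> u v /= hu hv; rewrite mulrBr rpredB.
  move=> _ [b [c [Ib Ic ->]]] /=; apply: addspan_sub.
  by exists (a * b), c; split; rewrite ?mulrA //; exact: Il.
- move=> a x /= /addspanP /(_ [set z | z * a \in ideal_pow I n.+1]); apply.
    split; first by rewrite /= mul0r rpred0.
    by move=> u v /= hu hv; rewrite mulrBl rpredB.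
  move=> _ [b [c [Ib Ic ->]]] /=; apply: addspan_sub.
  by exists b, (c * a); split; rewrite ?mulrA //; exact: IHr.
Qed.

Lemma ideal_pow_le (I : set R) n x : two_sided_ideal I ->
  x \in ideal_pow I n.+1 -> x \in ideal_pow I n.
Proof.
move=> Iid /= /addspanP /(_ [set z | z \in ideal_pow I n]); apply.
  exact: subgroup_pred.
move=> _ [a [b [_ hb ->]]]; have [_ h _] := ideal_pow_ideal n Iid; exact: h.
Qed.

Lemma ideal_pow1 (I : set R) x : two_sided_ideal I ->
  x \in ideal_pow I 1 -> I x.
Proof.
move=> [Isub _ Ir] /= /addspanP /(_ I); apply=> //.
by move=> _ [a [b [Ia _ ->]]]; exact: Ir.
Qed.

End Ideals.

(* k^r is [{ffun 'I_r -> k}] with its pointwise operations.  A homomorphism of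
   k-algebras is a ring morphism commuting with the scalars; the
   scalar action on k^r is spelled out, since k is an [lmodType k] only as k^o. *)
Record augmentedAlgebra (k : fieldType) (r : nat) : Type := AugmentedAlgebra {
  aug_alg :> algType k;
  aug_rho : {rmorphism {ffun 'I_r -> k} -> aug_alg};
  aug_pi : {rmorphism aug_alg -> {ffun 'I_r -> k}};
  aug_rhoZ : forall (c : k) (x : {ffun 'I_r -> k}),
    aug_rho [ffun i => c * x i] = c *: aug_rho x;
  aug_piZ : forall (c : k) (x : aug_alg),
    aug_pi (c *: x) = [ffun i => c * aug_pi x i];
  aug_rhoK : cancel aug_rho aug_pi }.

Section Augmented.
Variables (k : fieldType) (r : nat) (H : augmentedAlgebra k r).
Local Notation kr := {ffun 'I_r -> k}.
Local Notation rho := (@aug_rho k r H).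
Local Notation pi := (@aug_pi k r H).

Definition aug_ideal : set H := [set x | pi x = 0].

Lemma aug_ideal_ideal : two_sided_ideal aug_ideal.
Proof.
split=> [|a x|a x]; last 2 first.
- by rewrite /aug_ideal /= rmorphM => ->; rewrite mulr0.
- by rewrite /aug_ideal /= rmorphM => ->; rewrite mul0r.
by apply: subgroup_ker; exact: rmorphD.
Qed.

(* H / m^n, as a left H-module ... *)
Definition Hq (n : nat) : Type := Quotient.quot (ideal_pow aug_ideal n).
HB.instance Definition _ n := GRing.Zmodule.on (Hq n).

Definition Hpi n (x : H) : Hq n :=
  \pi_(Quotient.quot (ideal_pow aug_ideal n)) x.

Definition Hrep n (x : Hq n) : H :=
  repr (x : Quotient.quot (ideal_pow aug_ideal n)).

Definition Hq_scale n (a : H) (x : Hq n) : Hq n := Hpi n (a * Hrep x).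

(* ... and its right k^r-module structure *)
Definition Hq_ract n (x : Hq n) (c : kr) : Hq n := Hpi n (Hrep x * rho c).

Lemma HrepK n : cancel (@Hrep n) (@Hpi n).
Proof. exact: reprK. Qed.

Lemma HpiD n : {morph Hpi n : x y / x + y}.
Proof. exact: quot_piD. Qed.

Lemma Hpi_eq n x y : x - y \in ideal_pow aug_ideal n -> Hpi n x = Hpi n y.
Proof. exact: quot_pi_eq. Qed.

Lemma Hrep_pi n x : Hrep (Hpi n x) - x \in ideal_pow aug_ideal n.
Proof. exact: quot_repr. Qed.

Lemma Hq_scaleE n a x : Hq_scale a (Hpi n x) = Hpi n (a * x).
Proof.
apply: Hpi_eq; rewrite -mulrBr.
have [_ h _] := ideal_pow_ideal n aug_ideal_ideal; apply: h; exact: Hrep_pi.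
Qed.

Lemma Hq_ractE n x c : Hq_ract (Hpi n x) c = Hpi n (x * rho c).
Proof.
apply: Hpi_eq; rewrite -mulrBl.
have [_ _ h] := ideal_pow_ideal n aug_ideal_ideal; apply: h; exact: Hrep_pi.
Qed.

Fact Hq_scaleA n a b (x : Hq n) :
  Hq_scale a (Hq_scale b x) = Hq_scale (a * b) x.
Proof. by rewrite Hq_scaleE mulrA. Qed.
Fact Hq_scale1 n : left_id 1 (@Hq_scale n).
Proof. by move=> x; rewrite /Hq_scale mul1r HrepK. Qed.
Fact Hq_scaleDr n : right_distributive (@Hq_scale n) +%R.
Proof.
move=> a x y; rewrite -(HrepK x) -(HrepK y) -HpiD !Hq_scaleE.
by rewrite mulrDr HpiD.
Qed.
Fact Hq_scaleDl n x : {morph (@Hq_scale n)^~ x : a b / a + b}.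
Proof. by move=> a b; rewrite -HpiD -mulrDl. Qed.

HB.instance Definition _ n := GRing.Zmodule_isLmodule.Build H (Hq n)
  (@Hq_scaleA n) (@Hq_scale1 n) (@Hq_scaleDr n) (@Hq_scaleDl n).

Lemma HpiZ n a x : a *: Hpi n x = Hpi n (a * x).
Proof. exact: Hq_scaleE. Qed.

Definition Hq_res n (x : Hq n.+1) : Hq n := Hpi n (Hrep x).

Lemma Hq_resE n x : Hq_res (Hpi n.+1 x) = Hpi n x.
Proof.
by apply: Hpi_eq; apply: ideal_pow_le aug_ideal_ideal _; exact: Hrep_pi.
Qed.

Fact Hq_res_linear n : linear (@Hq_res n).
Proof.
move=> a x y; rewrite -(HrepK x) -(HrepK y) HpiZ -HpiD !Hq_resE.
by rewrite HpiD HpiZ.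
Qed.

HB.instance Definition _ n :=
  GRing.isLinear.Build H (Hq n.+1) (Hq n) *:%R (@Hq_res n) (@Hq_res_linear n).

Definition to_completion (x : H) : invlim (fun n => @Hq_res n) :=
  InvLim (fun n => Hq_resE n x).

Definition aug_complete : Prop := bijective to_completion.

Section CompletedTensor.
Variable M : lmodType kr.

(* (H / m^n) (x)_{k^r} M, a left H-module through H / m^n *)
Definition HqM (n : nat) : Type := tensor (@Hq_ract n) M.
HB.instance Definition _ n := GRing.Zmodule.on (HqM n).

Definition htens n (x : Hq n) (m : M) : HqM n := tens (@Hq_ract n) x m.

Lemma htens_balanced n : balanced (@Hq_ract n) (@htens n).
Proof. exact: tens_balanced. Qed.

Lemma HqM_ext n (Z : zmodType) (f g : HqM n -> Z) :
  {morph f : s t / s + t} -> {morph g : s t / s + t} ->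
  (forall x m, f (htens x m) = g (htens x m)) -> f =1 g.
Proof. exact: tensor_ext. Qed.

Lemma HqM_ind n (P : set (HqM n)) :
  subgroup P -> (forall x m, P (htens x m)) -> forall t, P t.
Proof. exact: tensor_ind. Qed.

Definition HqM_scale n (a : H) : HqM n -> HqM n :=
  tlift (fun (x : Hq n) (m : M) => htens (a *: x) m).

Fact HqM_scale_balanced n a :
  balanced (@Hq_ract n) (fun (x : Hq n) (m : M) => htens (a *: x) m).
Proof.
have [b1 b2 b3] := htens_balanced n; split=> [y x x'|x|x c y].
- by rewrite scalerDr b1.
- exact: b2.
- rewrite -(HrepK x) Hq_ractE !HpiZ mulrA -b3.
  by rewrite Hq_ractE.
Qed.

Lemma HqM_scaleE n a (x : Hq n) m : HqM_scale a (htens x m) = htens (a *: x) m.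
Proof. exact: (tlift_tens (HqM_scale_balanced n a)). Qed.

Fact HqM_scaleDr n : right_distributive (@HqM_scale n) +%R.
Proof. by move=> a; exact: (tliftD (HqM_scale_balanced n a)). Qed.

Fact HqM_scaleA n a b (t : HqM n) :
  HqM_scale a (HqM_scale b t) = HqM_scale (a * b) t.
Proof.
apply: (@HqM_ext n _ (fun t => HqM_scale a (HqM_scale b t))
  (HqM_scale (a * b)) _ _ _ t).
- by move=> u v; rewrite !HqM_scaleDr.
- by move=> u v; rewrite !HqM_scaleDr.
- by move=> x m; rewrite !HqM_scaleE scalerA.
Qed.

Fact HqM_scale1 n : left_id 1 (@HqM_scale n).
Proof.
apply: (@HqM_ext n _ (HqM_scale 1) id) => // [s t|x m]; first by rewrite HqM_scaleDr.
by rewrite HqM_scaleE scale1r.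
Qed.

Fact HqM_scaleDl n (t : HqM n) : {morph (@HqM_scale n)^~ t : a b / a + b}.
Proof.
move=> a b /=.
apply: (@HqM_ext n _ (HqM_scale (a + b))
  (fun t => HqM_scale a t + HqM_scale b t) _ _ _ t).
- by move=> u v; rewrite !HqM_scaleDr.
- by move=> u v; rewrite !HqM_scaleDr addrACA.
- move=> x m; rewrite !HqM_scaleE scalerDl.
  by have [b1 _ _] := htens_balanced n; rewrite b1.
Qed.

HB.instance Definition _ n := GRing.Zmodule_isLmodule.Build H (HqM n)
  (@HqM_scaleA n) (@HqM_scale1 n) (@HqM_scaleDr n) (@HqM_scaleDl n).

Lemma htensZ n a (x : Hq n) m : a *: htens x m = htens (a *: x) m.
Proof. exact: HqM_scaleE. Qed.

Definition HqM_res n : HqM n.+1 -> HqM n :=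
  tlift (fun (x : Hq n.+1) (m : M) => htens (Hq_res x) m).

Fact HqM_res_balanced n :
  balanced (@Hq_ract n.+1) (fun (x : Hq n.+1) (m : M) => htens (Hq_res x) m).
Proof.
have [b1 b2 b3] := htens_balanced n; split=> [y x x'|x|x c y].
- by rewrite linearD b1.
- exact: b2.
- by rewrite -(HrepK x) Hq_ractE !Hq_resE -b3 Hq_ractE.
Qed.

Lemma HqM_resE n (x : Hq n.+1) m : HqM_res (htens x m) = htens (Hq_res x) m.
Proof. exact: (tlift_tens (HqM_res_balanced n)). Qed.

Lemma HqM_resD n : {morph @HqM_res n : s t / s + t}.
Proof. exact: (tliftD (HqM_res_balanced n)). Qed.

Fact HqM_res_linear n : linear (@HqM_res n).
Proof.
move=> a s t; rewrite (@HqM_resD n).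
suff -> : HqM_res (a *: s) = a *: HqM_res s by [].
apply: (@HqM_ext n.+1 _ (fun s : HqM n.+1 => HqM_res (a *: s))
  (fun s : HqM n.+1 => a *: HqM_res s) _ _ _ s) => [u v|u v|x m].
- by rewrite scalerDr (@HqM_resD n).
- by rewrite (@HqM_resD n) scalerDr.
- by rewrite htensZ !HqM_resE htensZ [Hq_res _]linearZ.
Qed.

HB.instance Definition _ n := GRing.isLinear.Build H (HqM n.+1) (HqM n) *:%R
  (@HqM_res n) (@HqM_res_linear n).

(* The completed tensor product of H and M over k^r. *)
Definition hatM : Type := invlim (fun n => @HqM_res n).
HB.instance Definition _ := GRing.Lmodule.on hatM.
HB.instance Definition _ := Topological.on hatM.

Definition Ohat : Type := contEnd (fun n => @HqM_res n).
HB.instance Definition _ := GRing.PzRing.on Ohat.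
HB.instance Definition _ := GRing.Lmodule.on Ohat.

Fact hat1_subproof (m : M) n :
  HqM_res (htens (Hpi n.+1 1) m) = htens (Hpi n 1) m.
Proof. by rewrite HqM_resE Hq_resE. Qed.

(* 1 (x) m *)
Definition hat1 (m : M) : hatM := InvLim (hat1_subproof m).

(* The map hatM -> M sending h (x) m to pi(h) m; it factors through the
   component (H / m) (x) M. *)
Definition hat_red (x : hatM) : M :=
  tlift (fun (h : Hq 1) (m : M) => pi (Hrep h) *: m) (x 1%N).

(* The endomorphism of M induced by f: as [hat_red] is a surjection with
   section [hat1], it is determined by [hat_red_Ohat] below. *)
Definition Ohat_red (f : Ohat) (m : M) : M := hat_red (f (hat1 m)).

Lemma pi_rep (x : H) : pi (Hrep (Hpi 1 x)) = pi x.
Proof.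
apply/subr0_eq; rewrite -rmorphB.
by apply: (ideal_pow1 aug_ideal_ideal); exact: Hrep_pi.
Qed.

Fact hat_red_balanced :
  balanced (@Hq_ract 1) (fun (h : Hq 1) (m : M) => pi (Hrep h) *: m).
Proof.
split=> [y x x'|x y y'|x c y].
- rewrite -(HrepK x) -(HrepK x') -HpiD !pi_rep.
  by rewrite rmorphD scalerDl.
- by rewrite scalerDr.
- rewrite -(HrepK x) Hq_ractE !pi_rep rmorphM.
  by rewrite [pi (rho _)]aug_rhoK scalerA.
Qed.

Lemma hat_redD : {morph hat_red : x y / x + y}.
Proof. by move=> x y; exact: (tliftD hat_red_balanced). Qed.

Lemma hat_redZ (a : H) x : hat_red (a *: x) = pi a *: hat_red x.
Proof.
rewrite /hat_red coordZ.
pose L (t : HqM 1) : M :=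
  tlift (fun (h : Hq 1) (m : M) => pi (Hrep h) *: m) t.
have LD : {morph L : s t / s + t} by exact: (tliftD hat_red_balanced).
have Lt h m : L (htens h m) = pi (Hrep h) *: m.
  exact: (tlift_tens hat_red_balanced).
apply: (@HqM_ext 1 _ (fun t : HqM 1 => L (a *: t)) (fun t => pi a *: L t)
  _ _ _ (x 1%N)) => [s t|s t|h m].
- by rewrite scalerDr LD.
- by rewrite LD scalerDr.
- by rewrite htensZ !Lt -(HrepK h) HpiZ !pi_rep rmorphM scalerA.
Qed.

Lemma hat_red0 : hat_red 0 = 0.
Proof. by apply: (addrI (hat_red 0)); rewrite -hat_redD !addr0. Qed.

Lemma hat_redN : {morph hat_red : x / - x}.
Proof.
move=> x; apply: (addrI (hat_red x)).
by rewrite -hat_redD !subrr hat_red0.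
Qed.

Lemma hat1K : cancel hat1 hat_red.
Proof.
move=> m; rewrite /hat_red /= (tlift_tens hat_red_balanced).
by rewrite pi_rep rmorph1 scale1r.
Qed.

Lemma hat1D : {morph hat1 : x y / x + y}.
Proof.
move=> x y; apply: invlim_ext => n /=.
by have [_ b2 _] := htens_balanced n; rewrite b2.
Qed.

Lemma hat1Z (c : kr) m : hat1 (c *: m) = rho c *: hat1 m.
Proof.
apply: invlim_ext => n; rewrite coordZ /= htensZ HpiZ mulr1.
by have [_ _ b3] := htens_balanced n; rewrite -b3 Hq_ractE mul1r.
Qed.

Lemma Ohat_red_linear f : linear (Ohat_red f).
Proof.
move=> c x y; rewrite /Ohat_red hat1D hat1Z linearP hat_redD hat_redZ.
by rewrite aug_rhoK.
Qed.

Lemma Ohat_red0 f : Ohat_red f 0 = 0.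
Proof.
apply: (addrI (Ohat_red f 0)); rewrite addr0.
by have := Ohat_red_linear f 1 0 0; rewrite !scale1r addr0 => <-.
Qed.

Lemma hat_red_Ohat (f : Ohat) x : hat_red (f x) = Ohat_red f (hat_red x).
Proof.
have [N hN] := (continuous_invlimP f).1 (@cfun_continuous _ _ _ f) x 1%N.
have approx (t : HqM (maxn N 1)) : exists y : hatM,
    y (maxn N 1) = t /\ hat_red (f y) = Ohat_red f (hat_red y).
  move: t; apply: HqM_ind => [|h m].
    split; first by exists 0; rewrite linear0 hat_red0 Ohat_red0.
    move=> s t [y [<- hy]] [z [<- hz]]; exists (y - z); split=> //.
    transitivity (hat_red (f y) - hat_red (f z)).
      by rewrite linearB hat_redD hat_redN.
    have := Ohat_red_linear f (-1) (hat_red z) (hat_red y).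
    rewrite !scaleN1r [RHS]addrC hat_redD hat_redN hy hz => <-.
    by rewrite addrC.
  exists (Hrep h *: hat1 m); split.
    by rewrite coordZ /= htensZ HpiZ mulr1 HrepK.
  rewrite linearZ hat_redZ hat_redZ hat1K.
  have := Ohat_red_linear f (pi (Hrep h)) m 0.
  by rewrite Ohat_red0 !addr0.
have [y [xy hy]] := approx (x (maxn N 1)).
have fxy : f y 1%N = f x 1%N.
  by apply: hN; apply: coord_le xy; exact: leq_maxl.
have rxy : hat_red y = hat_red x.
  by rewrite /hat_red (coord_le _ xy) // leq_maxr.
by rewrite -rxy -hy /hat_red fxy.
Qed.

Lemma Ohat_redD f g m : Ohat_red (f + g) m = Ohat_red f m + Ohat_red g m.
Proof. exact: hat_redD. Qed.

Lemma Ohat_redM f g m : Ohat_red (f * g) m = Ohat_red g (Ohat_red f m).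
Proof. exact: (hat_red_Ohat g (f (hat1 m))). Qed.

Lemma Ohat_red1 m : Ohat_red 1 m = m.
Proof. exact: hat1K. Qed.

End CompletedTensor.
End Augmented.

Section DirectSum.
Variables (k : fieldType) (r : nat) (M : 'I_r -> lmodType k).
Local Notation kr := {ffun 'I_r -> k}.

(* The direct sum of the M i, as a k^r-module. *)
Definition dsum : Type := forall i, M i.
HB.instance Definition _ := gen_eqMixin dsum.
HB.instance Definition _ := gen_choiceMixin dsum.

Lemma dsum_ext (x y : dsum) : (forall i, x i = y i) -> x = y.
Proof. exact: functional_extensionality_dep. Qed.

Definition dsum0 : dsum := fun i => 0.
Definition dsum_add (x y : dsum) : dsum := fun i => x i + y i.
Definition dsum_opp (x : dsum) : dsum := fun i => - x i.
Definition dsum_scale (c : kr) (x : dsum) : dsum := fun i => c i *: x i.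

Fact dsum_addA : associative dsum_add.
Proof. by move=> x y z; apply: dsum_ext => i; exact: addrA. Qed.
Fact dsum_addC : commutative dsum_add.
Proof. by move=> x y; apply: dsum_ext => i; exact: addrC. Qed.
Fact dsum_add0 : left_id dsum0 dsum_add.
Proof. by move=> x; apply: dsum_ext => i; exact: add0r. Qed.
Fact dsum_addN : left_inverse dsum0 dsum_opp dsum_add.
Proof. by move=> x; apply: dsum_ext => i; exact: addNr. Qed.

HB.instance Definition _ := GRing.isZmodule.Build dsum
  dsum_addA dsum_addC dsum_add0 dsum_addN.

Fact dsum_scaleA a b x : dsum_scale a (dsum_scale b x) = dsum_scale (a * b) x.
Proof. by apply: dsum_ext => i; rewrite /dsum_scale scalerA ffunE. Qed.
Fact dsum_scale1 : left_id 1 dsum_scale.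
Proof. by move=> x; apply: dsum_ext => i; rewrite /dsum_scale ffunE scale1r. Qed.
Fact dsum_scaleDr : right_distributive dsum_scale +%R.
Proof. by move=> a x y; apply: dsum_ext => i; exact: scalerDr. Qed.
Fact dsum_scaleDl x : {morph dsum_scale^~ x : a b / a + b}.
Proof.
move=> a b; apply: dsum_ext => i.
by rewrite /dsum_scale ffunE; exact: scalerDl.
Qed.

HB.instance Definition _ := GRing.Zmodule_isLmodule.Build kr dsum
  dsum_scaleA dsum_scale1 dsum_scaleDr dsum_scaleDl.

Definition dsum_inj (i : 'I_r) (v : M i) : dsum := dfwith (fun j => 0) i v.

Lemma dsum_injD i : {morph @dsum_inj i : u v / u + v}.
Proof.
move=> u v; apply: dsum_ext => j; rewrite -[RHS]/(_ j + _ j) /dsum_inj.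
have [<-|ij] := eqVneq i j; first by rewrite !dfwithin.
by rewrite !dfwithout // addr0.
Qed.

Lemma dsum_injK i (v : M i) : dsum_inj v i = v.
Proof. exact: dfwithin. Qed.

Lemma dsum_idem i (x : dsum) :
  ([ffun j => (j == i)%:R] : kr) *: x = dsum_inj (x i).
Proof.
apply: dsum_ext => j; rewrite -[LHS]/(_ j *: _ j) ffunE /dsum_inj.
have [->|ji] := eqVneq j i; first by rewrite scale1r dfwithin.
by rewrite scale0r dfwithout // eq_sym.
Qed.

End DirectSum.

(* M i as a right module over Ohat H (dsum M), through the reduction to
   End_{k^r}(dsum M) and the projection of the latter to End_k(M i).  The
   argument H is a phantom selecting the module structure. *)
Definition Omodule (k : fieldType) (r : nat) (H : augmentedAlgebra k r)
  (M : 'I_r -> lmodType k) (i : 'I_r) : Type := M i.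

Section OhatModule.
Variables (k : fieldType) (r : nat) (H : augmentedAlgebra k r).
Variables (M : 'I_r -> lmodType k) (i : 'I_r).
Local Notation O := (Ohat H (dsum M)).
Local Notation Omod := (Omodule H M i).

HB.instance Definition _ := GRing.Zmodule.on Omod.

Definition Omod_scale (f : O^c) (v : Omod) : Omod :=
  Ohat_red (f : O) (dsum_inj (v : M i)) i.

Lemma Ohat_red_inj (f : O) (v : M i) :
  dsum_inj (Ohat_red f (dsum_inj v) i) = Ohat_red f (dsum_inj v).
Proof.
rewrite -dsum_idem; set e := [ffun j => _].
have := Ohat_red_linear f e (dsum_inj v) 0; rewrite Ohat_red0 !addr0 => <-.
by rewrite dsum_idem dsum_injK.
Qed.

Fact Omod_scaleA (f g : O^c) v :
  Omod_scale f (Omod_scale g v) = Omod_scale (f * g) v.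
Proof.
by rewrite /Omod_scale Ohat_red_inj -Ohat_redM.
Qed.
Fact Omod_scale1 : left_id 1 Omod_scale.
Proof. by move=> v; rewrite /Omod_scale Ohat_red1 dsum_injK. Qed.
Fact Omod_scaleDr : right_distributive Omod_scale +%R.
Proof.
move=> f u v; rewrite /Omod_scale dsum_injD.
by have := Ohat_red_linear f 1 (dsum_inj u) (dsum_inj v); rewrite !scale1r => ->.
Qed.
Fact Omod_scaleDl v : {morph Omod_scale^~ v : f g / f + g}.
Proof. by move=> f g; rewrite /Omod_scale Ohat_redD. Qed.

HB.instance Definition _ := GRing.Zmodule_isLmodule.Build O^c Omod
  Omod_scaleA Omod_scale1 Omod_scaleDr Omod_scaleDl.

End OhatModule.

(* The k-vector space underlying a right A-module. *)
Section Restriction.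
Variables (k : fieldType) (A : algType k) (V : lmodType A^c).

Definition kres : Type := V.
HB.instance Definition _ := GRing.Zmodule.on kres.

Definition kres_scale (c : k) (v : kres) : kres := (c%:A : A^c) *: (v : V).

Fact kres_scaleA a b v : kres_scale a (kres_scale b v) = kres_scale (a * b) v.
Proof.
rewrite /kres_scale scalerA; congr (_ *: _).
rewrite -[LHS]/((b%:A : A) * a%:A).
by rewrite -scalerAl mul1r scalerA mulrC.
Qed.
Fact kres_scale1 : left_id 1 kres_scale.
Proof. by move=> v; rewrite /kres_scale scale1r; exact: (@scale1r A^c). Qed.
Fact kres_scaleDr : right_distributive kres_scale +%R.
Proof. by move=> a u v; exact: scalerDr. Qed.
Fact kres_scaleDl v : {morph kres_scale^~ v : a b / a + b}.
Proof.
by move=> a b; rewrite /kres_scale scalerDl; exact: (@scalerDl A^c).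
Qed.

HB.instance Definition _ := GRing.Zmodule_isLmodule.Build k kres
  kres_scaleA kres_scale1 kres_scaleDr kres_scaleDl.

End Restriction.

Definition simple_module (R : pzRingType) (V : lmodType R) : Prop :=
  (exists v : V, v != 0) /\
  forall N : {pred V}, submod_closed N -> N =i pred1 0 \/ N =i predT.

Definition is_basis (k : fieldType) (V : lmodType k) (B : set V) : Prop :=
  (forall (s : seq V) (c : V -> k), uniq s -> (forall v, v \in s -> B v) ->
     \sum_(v <- s) c v *: v = 0 -> forall v, v \in s -> c v = 0) /\
  (forall v, exists (s : seq V) (c : V -> k),
     (forall u, u \in s -> B u) /\ v = \sum_(u <- s) c u *: u).

Definition has_countable_basis (k : fieldType) (V : lmodType k) : Prop :=
  exists B : set V, countable B /\ is_basis B.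

(* Main.v *)
(* Every k^r-linear endomorphism phi of M extends to 1 (x) phi, so the reduction
   from O = Ohat(M) to the product of the End_k(M_i) is surjective; hence each
   M_i, on which End_k(M_i) is transitive away from 0, is simple over O.  An
   endomorphism f reducing to 0 maps the kernel of the n-th projection of the
   completed tensor product into that of the (n+1)-st, so 1 - f is inverted by
   the geometric series, and the kernel of the reduction lies in every maximal
   ideal.  It remains that End_k(V), for V nonzero of countable dimension, has a
   unique maximal ideal: if f has infinite rank, pick v_0, v_1, ... with the
   f(v_n) independent, and b sending f(v_n) to the n-th vector of a countable
   spanning sequence; then b f is onto, and b f a = 1 for a section a of it. *)
From HB Require Import structures.
Require Import Defs.
From mathcomp Require Import all_boot all_order all_algebra.
From mathcomp Require Import all_classical topology.

Set Implicit Arguments.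
Unset Strict Implicit.
Unset Printing Implicit Defensive.
Import GRing.Theory.
Local Open Scope classical_set_scope.
Local Open Scope ring_scope.
Local Open Scope quotient_scope.

(** * Subspaces, spans, and extension of partial linear maps *)

Section Subspace.
Variable k : fieldType.
Implicit Types V W : lmodType k.

Definition subspace V (G : set V) : Prop :=
  G 0 /\ forall c x y, G x -> G y -> G (c *: x + y).

Definition lspan V (S : set V) : set V :=
  [set x | forall G, subspace G -> S `<=` G -> G x].

Lemma subspaceZ V (G : set V) c x : subspace G -> G x -> G (c *: x).
Proof. by move=> [G0 Gl] Gx; rewrite -[_ *: _]addr0; exact: Gl. Qed.

Lemma subspaceD V (G : set V) x y : subspace G -> G x -> G y -> G (x + y).
Proof. by move=> [_ Gl] Gx Gy; rewrite -[x]scale1r; exact: Gl. Qed.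

Lemma subspaceB V (G : set V) x y : subspace G -> G x -> G y -> G (x - y).
Proof. by move=> sG Gx Gy; rewrite addrC -scaleN1r; exact: sG.2. Qed.

Lemma lspan_subspace V (S : set V) : subspace (lspan S).
Proof.
split=> [G [] //|c x y hx hy G sG SG].
by apply: sG.2; [exact: hx | exact: hy].
Qed.

Lemma sub_lspan V (S : set V) : S `<=` lspan S.
Proof. by move=> x Sx G _; apply. Qed.

Lemma lspan_min V (S G : set V) : subspace G -> S `<=` G -> lspan S `<=` G.
Proof. by move=> sG SG x; apply. Qed.

Lemma subspace0 V : subspace [set 0 : V].
Proof. by split=> // c x y -> ->; rewrite /= scaler0 addr0. Qed.

Lemma lspan_set0 V (x : V) : x != 0 -> ~ lspan set0 x.
Proof.
by move=> /negPf x0 /(lspan_min (@subspace0 V) (@sub0set _ _)) /eqP; rewrite x0.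
Qed.

Lemma lspanS V (S T : set V) : S `<=` T -> lspan S `<=` lspan T.
Proof.
move=> ST; apply: lspan_min; first exact: lspan_subspace.
by move=> x /ST; exact: sub_lspan.
Qed.

Lemma subspace_preimage V W (f : {linear V -> W}) (G : set W) :
  subspace G -> subspace (f @^-1` G).
Proof.
move=> [G0 Gl]; split; first by rewrite /preimage /= linear0.
by move=> c x y hx hy; rewrite /preimage /= linearP; exact: Gl.
Qed.

Lemma subspace_range V W (f : {linear V -> W}) : subspace (range f).
Proof.
split; first by exists 0 => //; rewrite linear0.
by move=> c _ _ [x _ <-] [y _ <-]; exists (c *: x + y) => //; rewrite linearP.
Qed.

Definition adjoin V (v : V) (G : set V) : set V :=
  [set x | exists c y, G y /\ x = c *: v + y].

Lemma adjoin_subspace V (v : V) G : subspace G -> subspace (adjoin v G).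
Proof.
move=> sG; split; first by exists 0, 0; rewrite scale0r addr0; split=> //; exact: sG.1.
move=> c _ _ [a [x [Gx ->]]] [b [y [Gy ->]]].
exists (c * a + b), (c *: x + y); split; first exact: sG.2.
by rewrite scalerDr scalerA scalerDl addrACA.
Qed.

Lemma sub_adjoin V (v : V) G : G `<=` adjoin v G.
Proof. by move=> x Gx; exists 0, x; rewrite scale0r add0r. Qed.

Lemma adjoin_mem V (v : V) G : subspace G -> adjoin v G v.
Proof. by move=> sG; exists 1, 0; rewrite scale1r addr0; split=> //; exact: sG.1. Qed.

(** Subspaces of [V * W] serve as graphs of partial linear maps; such a graph is single-valued when
    [(0, y)] forces [y = 0]. A nonzero coefficient of [(v, w)] could be divided out, which would put
    [v] in the domain of [G]. *)
Lemma adjoin_functional V W (v : V) (w : W) (G : set (V * W)) :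
  subspace G -> (forall y, ~ G (v, y)) -> (forall y, G (0, y) -> y = 0) ->
  forall y, adjoin (v, w) G (0, y) -> y = 0.
Proof.
move=> sG Gv G0 y [c [[x z] [Gxz]]] [].
have [->|c0] := eqVneq c 0.
  by rewrite !scale0r !add0r => x0 ->; apply: G0; rewrite x0.
move=> /esym/eqP; rewrite addrC addr_eq0 => /eqP xE _.
case: (Gv (- c^-1 *: z)); have := subspaceZ (- c^-1) sG Gxz.
by rewrite xE -[_ *: (_, _)]/(_ *: _, _ *: _) scalerN scaleNr opprK scalerA mulVf // scale1r.
Qed.

(* Zorn's lemma on the partial linear functions between G0 and Gamma. *)
Lemma linear_selection V W (Gamma G0 : set (V * W)) :
  subspace Gamma -> (forall x, exists y, Gamma (x, y)) ->
  subspace G0 -> G0 `<=` Gamma -> (forall y, G0 (0, y) -> y = 0) ->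
  exists h : {linear V -> W},
    (forall x, Gamma (x, h x)) /\ (forall x y, G0 (x, y) -> h x = y).
Proof.
move=> sGamma totGamma sG0 G0Gamma funG0.
pose Q (G : set (V * W)) :=
  [/\ subspace G, G `<=` Gamma & forall y, G (0, y) -> y = 0].
have QG0 : Q G0 by [].
(* The chains include the empty one, whose union is empty and so not a subspace; joining [G0] to
   every set repairs this. *)
have [|A [[sG GGamma funG] maxA]] := @Zorn_bigcup _ (fun A => Q (A `|` G0)).
  move=> F FP Ftot.
  have common p q : (\bigcup_(X in F) X `|` G0) p -> (\bigcup_(X in F) X `|` G0) q ->
      exists A, [/\ Q (A `|` G0), A `<=` \bigcup_(X in F) X,
        (A `|` G0) p & (A `|` G0) q].
    have FU X : F X -> X `<=` \bigcup_(X in F) X by move=> FX x Xx; exists X.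
    move=> [[X FX Xp]|G0p] [[Y FY Yq]|G0q].
    - have [XY|YX] := Ftot X Y FX FY.
        by exists Y; split; [exact: FP|exact: FU|left; exact: XY|left].
      by exists X; split; [exact: FP|exact: FU|left|left; exact: YX].
    - by exists X; split; [exact: FP|exact: FU|left|right].
    - by exists Y; split; [exact: FP|exact: FU|right|left].
    - by exists set0; rewrite set0U; split.
  split.
  - split; first by right; exact: sG0.1.
    move=> c p q hp hq; have [A [[sA _ _] AU Ap Aq]] := common p q hp hq.
    by case: (sA.2 c p q Ap Aq) => [/AU|]; [left|right].
  - move=> p hp; have [A [[_ AG _] _ Ap _]] := common p p hp hp; exact: AG.
  - move=> y hy; have [A [[_ _ fA] _ Ay _]] := common _ _ hy hy; exact: fA.
set G := A `|` G0 in sG GGamma funG.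
(* If [x] were outside the domain, adjoining a pair of [Gamma] over [x] would contradict
   maximality. *)
have totG x : exists y, G (x, y).
  apply: contrapT => /forallNP Gx; have [y xy] := totGamma x.
  have G'E : adjoin (x, y) G `|` G0 = adjoin (x, y) G.
    by apply/setUidPl => p G0p; apply: sub_adjoin; right.
  apply: (maxA (adjoin (x, y) G)).
    split; last by move=> /(_ _ (adjoin_mem _ sG)) Axy; apply: (Gx y); left.
    by move=> p Ap; apply: sub_adjoin; left.
  rewrite /= G'E; split; first exact: adjoin_subspace.
    by move=> _ [c [q [Gq ->]]]; apply: sGamma.2 => //; exact: GGamma.
  exact: adjoin_functional.
have uniqG x y y' : G (x, y) -> G (x, y') -> y = y'.
  move=> h h'; apply/subr0_eq/funG; have := subspaceB sG h h'.
  by rewrite -[(x, y) - (x, y')]/(x - x, y - y') subrr.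
have [h hG] := choice totG.
have hl : linear h.
  move=> c x y; apply: (uniqG (c *: x + y)) => //.
  exact: (sG.2 c (x, h x) (y, h y)).
exists (HB.pack_for {linear V -> W} h (GRing.isLinear.Build k V W *:%R h hl)).
split=> [x|x y xy] /=; first exact: GGamma.
by apply: (uniqG x) => //; right.
Qed.

Lemma linear_extension V W (G0 : set (V * W)) :
  subspace G0 -> (forall y, G0 (0, y) -> y = 0) ->
  exists h : {linear V -> W}, forall x y, G0 (x, y) -> h x = y.
Proof.
move=> sG0 fG0; have sT : subspace [set: V * W] by [].
have tT x : exists y : W, [set: V * W] (x, y) by exists 0.
by have [h [_ hG]] := linear_selection sT tT sG0 (@subsetT _ G0) fG0; exists h.
Qed.

(** A section is a linear selection from the transposed graph of [f], starting from the zero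
    subspace. *)
Lemma linear_section V W (f : {linear V -> W}) :
  (forall y, exists x, f x = y) -> exists g : {linear W -> V}, cancel g f.
Proof.
move=> fsurj.
have [||||z|g [gP _]] :=
    @linear_selection W V [set p | f p.2 = p.1] [set p | p = 0].
- split=> [|c [x y] [x' y']] /=; first by rewrite linear0.
  by rewrite linearP => -> ->.
- exact: fsurj.
- by split=> // c x y /= -> ->; rewrite scaler0 addr0.
- by move=> _ /= ->; rewrite linear0.
- by case.
- by exists g.
Qed.

(** The graph that is 0 on [lspan S], with [(u, w)] adjoined, is single-valued because [u] lies
    outside the span. With [S] empty, this sends a nonzero vector to any prescribed one. *)
Lemma linear_separation V W (S : set V) (u : V) (w : W) :
  ~ lspan S u -> exists h : {linear V -> W}, (forall v, S v -> h v = 0) /\ h u = w.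
Proof.
move=> Su.
pose G : set (V * W) := [set p | lspan S p.1 /\ p.2 = 0].
have sG : subspace G.
  split; first by split=> //; exact: (lspan_subspace S).1.
  move=> c [x y] [x' y'] [/= hx ->] [/= hx' ->]; split=> /=.
    exact: (lspan_subspace S).2.
  by rewrite scaler0 addr0.
have fG y : adjoin (u, w) G (0, y) -> y = 0.
  by apply: adjoin_functional => // z [].
have [h hG] := linear_extension (adjoin_subspace (u, w) sG) fG.
exists h; split=> [v Sv|]; apply: hG; last exact: adjoin_mem.
by apply: sub_adjoin; split=> //; exact: sub_lspan.
Qed.

End Subspace.

(** * Two-sided ideals of the endomorphisms of a countably spanned space *)

Section EndomorphismIdeals.
Variables (k : fieldType) (V : lmodType k).

Lemma subspace_fixpoints (g : {linear V -> V}) : subspace [set x | g x = x].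
Proof.
by split=> [|c x y /= gx gy]; [exact: linear0 | rewrite linearP gx gy].
Qed.

Definition finitely_spanned : Prop := exists s : seq V, forall v, lspan [set` s] v.

Definition finite_range (f : V -> V) : Prop :=
  exists s : seq V, forall v, lspan [set` s] (f v).

(* The maximal two-sided ideal of End_k(V), when V is nonzero of countable
   dimension: 0 if V is finite-dimensional, else the maps of finite rank. *)
Definition negligible (f : V -> V) : Prop :=
  finite_range f /\ (finitely_spanned -> forall v, f v = 0).

Lemma negligible0 : negligible (fun=> 0).
Proof. by split=> //; exists [::] => v; exact: (lspan_subspace _).1. Qed.

Lemma negligibleB (f g : V -> V) :
  negligible f -> negligible g -> negligible (fun v => f v - g v).
Proof.
move=> [[s fs] f0] [[t gt] g0]; split; last first.
  by move=> fV v; rewrite f0 // g0 // subrr.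
exists (s ++ t) => v; apply: subspaceB (lspan_subspace _) _ _.
  by apply: lspanS (fs v) => x /=; rewrite mem_cat => ->.
by apply: lspanS (gt v) => x /=; rewrite mem_cat => ->; rewrite orbT.
Qed.

Lemma negligible_comp (f : V -> V) (a b : {linear V -> V}) :
  negligible f -> negligible (b \o f \o a).
Proof.
move=> [[s fs] f0]; split; last by move=> fV v /=; rewrite f0 ?linear0.
exists (map b s) => v /=; move: (fs (a v)).
apply: (@lspan_min _ _ _ (b @^-1` lspan [set` map b s])).
  exact/subspace_preimage/lspan_subspace.
by move=> x xs; apply: sub_lspan; exact: map_f.
Qed.

Lemma not_negligible_id (v : V) : v != 0 -> ~ negligible id.
Proof. by move=> /eqP v0 [fV] /(_ fV) /(_ v). Qed.

Variable K : set {linear V -> V}.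
Hypothesis KD : forall f g, K f -> K g -> K (f \+ g : {linear V -> V}).
Hypothesis KM : forall (a f b : {linear V -> V}), K f -> K (b \o f \o a : {linear V -> V}).

(** Suppose [g] fixes [s] but not [u]. Then [u] is outside the span of [s], so some [a] kills [s]
    and sends [u] to [v]; with [b] sending [f v] to [u - g u], the map [g + b f a] fixes [u] as
    well. *)
Lemma ideal_fix_seq (f : {linear V -> V}) v (s : seq V) :
  K f -> f v != 0 -> exists2 g, K g & forall x, x \in s -> g x = x.
Proof.
move=> Kf fv0; elim: s => [|u s [g Kg gs]]; first by exists f.
have [gu|/eqP gu] := pselect (g u = u).
  by exists g => // x; rewrite inE => /predU1P[->|/gs].
have fix_sub := subspace_fixpoints g.
have su : ~ lspan [set` s] u.
  by move=> /(lspan_min fix_sub gs) /eqP; rewrite (negPf gu).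
have [a [as0 au]] := linear_separation v su.
have [b [_ bfv]] := linear_separation (u - g u) (lspan_set0 fv0).
exists (g \+ (b \o f \o a)); first by apply: KD => //; exact: KM.
move=> x; rewrite inE => /predU1P[->|xs] /=.
  by rewrite au bfv addrC subrK.
by rewrite as0 // !linear0 addr0 gs.
Qed.

Lemma ideal_infinite_range (e : nat -> V) (f : {linear V -> V}) :
  (forall v, lspan (range e) v) -> K f -> ~ finite_range f ->
  exists2 g, K g & g =1 id.
Proof.
move=> eV Kf /forallNP finf.
have /choice[pick pickP] (s : seq V) : exists v, ~ lspan [set` s] (f v).
  exact/existsNP.
(* [L n] lists the images of the first [n] chosen vectors; the next vector is picked with its image
   outside their span. *)
pose L := fix L n : seq V := if n is n'.+1 then f (pick (L n')) :: L n' else [::].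
pose w n := f (pick (L n)).
(* [G n] is the graph of the partial map [w i |-> e i] for [i < n]; the union of these graphs
   extends to [b]. *)
pose G := fix G n : set (V * V) :=
  if n is n'.+1 then adjoin (w n', e n') (G n') else [set 0].
have sG n : subspace (G n).
  by elim: n => [|n IH]; [exact: subspace0 | exact: adjoin_subspace].
have GL n x y : G n (x, y) -> lspan [set` L n] x.
  elim: n x y => [|n IH] x y.
    by move=> [-> _]; exact: (lspan_subspace _).1.
  move=> [c [[x' y'] [Gxy [-> _]]]]; apply: (lspan_subspace _).2.
    by apply: sub_lspan; rewrite /= inE eqxx.
  by apply: lspanS (IH _ _ Gxy) => z zL; rewrite /= inE [z \in _]zL orbT.
have fG n y : G n (0, y) -> y = 0.
  elim: n y => [y []//|n IH]; apply: adjoin_functional => // y.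
  by move=> /GL; exact: pickP.
have Gle m n : (m <= n)%N -> G m `<=` G n.
  move=> /subnK <-; elim: (n - m)%N => [//|d IH] p /IH.
  exact: sub_adjoin.
have sU : subspace (\bigcup_n G n).
  split; first by exists 0%N => //.
  move=> c p q [m _ Gp] [n _ Gq]; exists (maxn m n) => //.
  apply: (sG _).2; first exact: Gle (leq_maxl _ _) _ Gp.
  exact: Gle (leq_maxr _ _) _ Gq.
have [|b bG] := linear_extension sU; first by move=> y [n _ /fG].
have bw n : b (w n) = e n by apply: bG; exists n.+1 => //; exact: adjoin_mem.
have surj y : exists x, (b \o f) x = y.
  have : range (b \o f) y by apply: lspan_min (eV y) => [|_ [n _ <-]];
    [exact: subspace_range | exists (pick (L n)) => //; exact: bw].
  by move=> [x _ <-]; exists x.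
have [a aK] := linear_section surj.
by exists (b \o f \o a); [exact: KM | exact: aK].
Qed.

(** A map of finite range that is not negligible is nonzero on a finitely spanned [V], and
    [ideal_fix_seq] applies to a spanning list. *)
Lemma ideal_not_negligible (e : nat -> V) (f : {linear V -> V}) :
  (forall v, lspan (range e) v) -> K f -> ~ negligible f ->
  exists2 g, K g & g =1 id.
Proof.
move=> eV Kf nf; have [fr|] := pselect (finite_range f); last first.
  exact: (ideal_infinite_range eV).
have [[s sV]|nV] := pselect finitely_spanned; last by case: nf.
have [v /eqP fv] : exists v, f v <> 0.
  by apply/existsNP => f0; apply: nf; split.
have [g Kg gs] := ideal_fix_seq s Kf fv.
exists g => // x; apply: (lspan_min _ gs) (sV x).
exact: subspace_fixpoints.
Qed.

End EndomorphismIdeals.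

Lemma countable_basis_span (k : fieldType) (V : lmodType k) :
  has_countable_basis V -> exists e : nat -> V, forall v, lspan (range e) v.
Proof.
move=> [B [cB [_ spanB]]].
have [e Be] : exists e : nat -> V, B `<=` range e.
  (* A nonempty countable set is enumerated by [nat]; for an empty one any sequence will do. *)
  have /pfcard_geP[->|[e]] : (B #<= [set: nat])%card by [].
    by exists (fun=> 0).
  by exists e => b Bb; have [n _ <-] := @surj _ _ _ _ e b Bb; exists n.
exists e => v; have [s [c [sB ->]]] := spanB v.
have sE := lspan_subspace (range e); rewrite big_seq.
elim/big_ind: _ => [|x y hx hy|u us]; first exact: sE.1.
  exact: subspaceD sE hx hy.
by apply: (subspaceZ _ sE); apply: sub_lspan; apply: Be; apply: sB.
Qed.

(** * The adic filtration and the kernel of the reduction *)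

Lemma morphD0 (U V : zmodType) (f : U -> V) : {morph f : x y / x + y} -> f 0 = 0.
Proof. by move=> fD; apply: (addrI (f 0)); rewrite -fD !addr0. Qed.

Lemma morphDN (U V : zmodType) (f : U -> V) :
  {morph f : x y / x + y} -> {morph f : x / - x}.
Proof.
by move=> fD x; apply: (addrI (f x)); rewrite -fD !subrr; exact: morphD0.
Qed.

Section FiltrationOfOhat.
Variables (k : fieldType) (r : nat) (H : augmentedAlgebra k r).
Local Notation kr := {ffun 'I_r -> k}.
Local Notation pi := (@aug_pi k r H).
Local Notation rho := (@aug_rho k r H).
Local Notation mpow := (ideal_pow (@aug_ideal k r H)).
Variable M : lmodType kr.
Local Notation hM := (hatM H M).
Local Notation HM n := (HqM H M n).
Implicit Types (x y z : hM) (f : Ohat H M).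

(** [ideal_pow] adds new factors on the left, so a factor on the right has to be carried through by
    induction. *)
Lemma ideal_powMr n (h y : H) :
  h \in mpow n -> aug_ideal y -> h * y \in mpow n.+1.
Proof.
move=> hn Iy; elim: n h hn => [|n IH] h hn.
  apply: addspan_sub; exists (h * y), 1; rewrite mulr1; split=> //.
  by have [_ Il _] := aug_ideal_ideal H; exact: Il.
have Isub := subgroup_pred (mpow n.+2).
move: hn => /addspanP /(_ [set h | h * y \in mpow n.+2]); apply.
  split=> [|a b ha hb] /=; first by rewrite mul0r; exact: Isub.1.
  by rewrite mulrBl; exact: Isub.2.
move=> _ [a [b [Ia bn ->]]] /=; rewrite -mulrA; apply: addspan_sub.
by exists a, (b * y); split=> //; exact: IH.
Qed.

(** Generators of the image of [m^n (x) M] in [(H / m^N) (x) M]. *)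
Definition htens_pow N n : set (HM N) :=
  [set t | exists h m, h \in mpow n /\ t = htens (Hpi N h) m].

Lemma hat_coordB x y n : (x - y) n = x n - y n. Proof. by []. Qed.

(** Sums of elements [h (1 (x) m)] reach every element at level [N], so an additive property checked
    on these generators holds for some lift of any [t]. *)
Lemma hat_surj N (P : hM -> Prop) :
  subgroup P -> (forall h m, P (h *: hat1 H m)) ->
  forall t : HM N, exists2 x, P x & x N = t.
Proof.
move=> [P0 PB] Pgen; apply: HqM_ind.
  split; first by exists 0.
  by move=> s t [x Px <-] [y Py <-]; exists (x - y) => //; exact: PB.
move=> h m; exists (Hrep h *: hat1 H m) => //.
by rewrite coordZ /= htensZ HpiZ mulr1 HrepK.
Qed.

(* Right exactness of the tensor product: h (x) m |-> [h (x) m] inverts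
   (H / m^N) (x) M / im (m^n (x) M) -> (H / m^n) (x) M. *)
Lemma coord_eq0_pow x n N : (n <= N)%N -> x n = 0 ->
  x N \in addspan (@htens_pow N n).
Proof.
move=> nN xn0; set I := addspan _.
pose Q := Quotient.quot I.
(* Lift a class modulo [m^n] to one modulo [m^N]; the choice of the lift disappears modulo [I]. *)
pose b (h : Hq H n) (m : M) : Q := \pi_Q (htens (Hpi N (Hrep h)) m).
have [t1 t2 t3] := htens_balanced H M N.
have piE h m : b (Hpi n h) m = \pi_Q (htens (Hpi N h) m).
  apply: quot_pi_eq; apply: addspan_sub.
  exists (Hrep (Hpi n h) - h), m; split; first exact: Hrep_pi.
  have HN : Hpi N (Hrep (Hpi n h)) = Hpi N (Hrep (Hpi n h) - h) + Hpi N h.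
    by rewrite -HpiD subrK.
  by rewrite HN t1 addrK.
have bb : balanced (@Hq_ract k r H n) b.
  split=> [m h h'|h m m'|h c m].
  - by rewrite -(HrepK h) -(HrepK h') -HpiD !piE HpiD t1 quot_piD.
  - by rewrite /b t2 quot_piD.
  - by rewrite -(HrepK h) Hq_ractE !piE -t3 Hq_ractE.
have bD := tliftD bb.
have bE : forall t m, tlift b (htens t m) = b t m by exact: tlift_tens bb.
have pi0 := quot_pi0 I.
have b0 := morphD0 bD.
(* The identity is checked on generators only, hence [x] is replaced by some [y] with the same
   [N]-th coordinate. *)
have [||y yE yN] := @hat_surj N (fun y => tlift b (y n) = \pi_Q (y N)) _ _ (x N).
- split; first exact: etrans b0 (esym pi0).
  by move=> u v hu hv; rewrite !hat_coordB quot_piD quot_piN -hu -hv bD (morphDN bD).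
- by move=> h m; rewrite !coordZ /= !htensZ !HpiZ mulr1 bE piE.
have yn : y n = 0 by rewrite -xn0; exact: coord_le nN yN.
have : \pi_Q (x N) = \pi_Q 0 by rewrite -yN -yE yn b0 pi0.
by move=> /eqP; rewrite -Quotient.idealrBE subr0.
Qed.

(** The coordinate [x n.+1] is a sum of tensors [y (x) m] with [y] in the augmentation ideal, and
    then [h * y] vanishes modulo its power [n.+1]. *)
Lemma pow_scale_coord n h x :
  h \in mpow n -> x 1%N = 0 -> h *: x n.+1 = 0.
Proof.
move=> hn x1.
have /addspanP /(_ [set t | h *: t = 0]) := coord_eq0_pow (ltn0Sn n) x1.
apply; first by split=> [|s t /= hs ht]; rewrite /= ?scaler0 // scalerBr hs ht subrr.
move=> _ [y [m [y1 ->]]] /=; rewrite htensZ HpiZ.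
have hy : h * y \in mpow n.+1.
  by apply: ideal_powMr => //; exact: ideal_pow1 (aug_ideal_ideal H) y1.
have -> : Hpi n.+1 (h * y) = Hpi n.+1 0 by apply: Hpi_eq; rewrite subr0.
have [t1 _ _] := htens_balanced H M n.+1.
have -> : Hpi n.+1 (0 : H) = 0 by exact: quot_pi0.
exact: morphD0 (t1 m).
Qed.

(** The map [m |-> 1 (x) m] inverts the reduction of [(H / m) (x) M]: [h] agrees with [rho (pi h)]
    modulo the ideal, and [rho] slides across the tensor. *)
Lemma hat_red_eq0 x : hat_red x = 0 -> x 1%N = 0.
Proof.
move=> x0; have [t1 t2 t3] := htens_balanced H M 1.
have bD := tliftD (hat_red_balanced H M).
have bE := tlift_tens (hat_red_balanced H M).
suff E : id =1 (fun t : HM 1 => htens (Hpi 1 1) (tlift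
    (fun (h : Hq H 1) (m : M) => pi (Hrep h) *: m) t)).
  rewrite [LHS]E -/(hat_red x) x0; exact: morphD0 (t2 _).
apply: HqM_ext => // [s t|h m]; first by rewrite bD t2.
rewrite bE -t3 Hq_ractE mul1r; congr htens.
rewrite -{1}(HrepK h); apply: Hpi_eq; apply: addspan_sub.
exists (Hrep h - rho (pi (Hrep h))), 1; rewrite mulr1; split=> //.
by rewrite /aug_ideal /= rmorphB aug_rhoK subrr.
Qed.

Lemma coord0_eq0 x : x 0%N = 0.
Proof.
move: (x 0%N); apply: HqM_ind; first by split=> // s t -> ->; rewrite subrr.
move=> h m; have [t1 _ _] := htens_balanced H M 0.
have -> : h = 0.
  rewrite -(HrepK h) -[RHS](quot_pi0 (mpow 0)); exact: Hpi_eq.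
exact: morphD0 (t1 m).
Qed.

(** By continuity [x] may be replaced by a sum of [h (1 (x) m)] with [h] in the [n]-th power.
    Linearity moves [h] outside [f], and [f (1 (x) m)] already vanishes at level 1. *)
Lemma Ohat_red_eq0_coord f x n :
  Ohat_red f =1 (fun=> 0) -> x n = 0 -> f x n.+1 = 0.
Proof.
move=> f0 xn.
have [N0 hN0] := (continuous_invlimP f).1 (@cfun_continuous _ _ _ f) x n.+1.
pose N := maxn N0 n.
have fm1 m : f (hat1 H m) 1%N = 0 by apply: hat_red_eq0; exact: f0.
have /addspanP /(_ [set t | exists2 y : hM, y N = t & f y n.+1 = 0]) :=
  coord_eq0_pow (leq_maxr N0 n) xn.
case.
- split; first by exists 0; rewrite ?linear0.
  move=> s t [y <- fy] [z <- fz]; exists (y - z) => //.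
  by rewrite linearB hat_coordB fy fz subrr.
- move=> _ [h [m [hn ->]]]; exists (h *: hat1 H m).
    by rewrite coordZ /= htensZ HpiZ mulr1.
  by rewrite linearZ coordZ; exact: pow_scale_coord hn (fm1 m).
move=> y yN fy; rewrite -fy; symmetry; apply: hN0.
by apply: coord_le yN; exact: leq_maxl.
Qed.

Lemma Ohat_exp_coord f x n : Ohat_red f =1 (fun=> 0) -> (f ^+ n) x n = 0.
Proof.
move=> f0; elim: n => [|n IH]; first exact: coord0_eq0.
by rewrite exprSr; exact: (Ohat_red_eq0_coord f0 IH).
Qed.

Lemma Ohat_geometric f : Ohat_red f =1 (fun=> 0) ->
  exists g : Ohat H M, (1 - f) * g = 1.
Proof.
(* At level [n] the terms from [f ^+ n] on vanish, so [n] terms give the [n]-th coordinate of the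
   whole series. *)
move=> f0; pose s n : Ohat H M := \sum_(i < n) f ^+ i.
have sS n : s n.+1 = s n + f ^+ n by exact: big_ord_recr.
have sP x n : HqM_res (s n.+1 x n.+1) = s n x n.
  rewrite coordP sS; transitivity (s n x n + (f ^+ n) x n) => //.
  by rewrite Ohat_exp_coord // addr0.
pose g x : hM := InvLim (sP x).
have gl : linear g.
  by move=> c x y; apply: invlim_ext => n; rewrite /= linearP.
have gc : continuous g.
  apply/continuous_invlimP => x n.
  exact: (continuous_invlimP (s n)).1 (@cfun_continuous _ _ _ (s n)) x n.
exists (ContEnd gl gc); apply: contEnd_ext => x; apply: invlim_ext => n /=.
rewrite -[LHS]/(((1 - f) * s n : Ohat H M) x n) /s.
have -> : (1 - f) * \sum_(i < n) f ^+ i = 1 - f ^+ n.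
  by rewrite -[RHS]opprB subrX1 -mulNr opprB.
by rewrite -[LHS]/(x n - (f ^+ n) x n) Ohat_exp_coord // subr0.
Qed.

(** * Lifting endomorphisms of [M] to the completed tensor product *)

Section Lift.
Variable phi : {linear M -> M}.

Fact Ohat_lift_balanced n :
  balanced (@Hq_ract k r H n) (fun (h : Hq H n) (m : M) => htens h (phi m)).
Proof.
have [t1 t2 t3] := htens_balanced H M n; split=> [m h h'|h m m'|h c m].
- exact: t1.
- by rewrite linearD t2.
- by rewrite t3 linearZ.
Qed.

Definition HqM_map n : HM n -> HM n :=
  tlift (fun (h : Hq H n) (m : M) => htens h (phi m)).

Lemma HqM_mapE n h m : HqM_map (htens h m) = htens h (phi m) :> HM n.
Proof. exact: (tlift_tens (Ohat_lift_balanced n)). Qed.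

Lemma HqM_mapD n : {morph @HqM_map n : s t / s + t}.
Proof. exact: (tliftD (Ohat_lift_balanced n)). Qed.

Lemma HqM_mapZ n (a : H) (t : HM n) : HqM_map (a *: t) = a *: HqM_map t.
Proof.
apply: (@HqM_ext _ _ H M n _ (fun t => HqM_map (a *: t)) (fun t => a *: HqM_map t)).
- by move=> u v /=; rewrite scalerDr; exact: HqM_mapD.
- by move=> u v /=; rewrite [HqM_map _]HqM_mapD; exact: scalerDr.
- by move=> h m; rewrite /= htensZ (HqM_mapE (a *: h)) (HqM_mapE h) htensZ.
Qed.

Fact HqM_map_res x n : HqM_res (HqM_map (x n.+1)) = HqM_map (x n).
Proof.
rewrite -(coordP x n).
apply: (@HqM_ext _ _ H M n.+1 _ (fun t => HqM_res (HqM_map t))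
  (fun t => HqM_map (HqM_res t))).
- by move=> u v /=; rewrite [HqM_map _]HqM_mapD; exact: HqM_resD.
- by move=> u v; exact: etrans (congr1 _ (HqM_resD u v)) (HqM_mapD _ _).
- by move=> h m; rewrite /= (HqM_mapE h) !HqM_resE (HqM_mapE (Hq_res h)).
Qed.

Definition hat_map x : hM := InvLim (HqM_map_res x).

Fact hat_map_linear : linear hat_map.
Proof. by move=> c x y; apply: invlim_ext => n; rewrite /= HqM_mapD HqM_mapZ. Qed.

Fact hat_map_continuous : continuous hat_map.
Proof. by apply/continuous_invlimP => x n; exists n => y /= ->. Qed.

Definition Ohat_map : Ohat H M := ContEnd hat_map_linear hat_map_continuous.

Lemma Ohat_red_map : Ohat_red Ohat_map =1 phi.
Proof.
move=> m; rewrite -[RHS](hat1K H); congr hat_red.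
by apply: invlim_ext => n /=; rewrite HqM_mapE.
Qed.

End Lift.
End FiltrationOfOhat.

(** * Diagonal components and the maximal ideals of [Ohat] *)

Lemma idealD (R : pzRingType) (K : set R) (x y : R) :
  two_sided_ideal K -> K x -> K y -> K (x + y).
Proof.
move=> [[K0 KB] _ _] Kx Ky; rewrite -[y]opprK; apply: (KB) => //.
by rewrite -sub0r; exact: KB.
Qed.

Section DiagonalComponents.
Variables (k : fieldType) (r : nat) (H : augmentedAlgebra k r).
Variable V : 'I_r -> lmodType k.
Local Notation kr := {ffun 'I_r -> k}.
Local Notation D := (dsum V).
Local Notation O := (Ohat H D).
Implicit Types (f g : O) (i j : 'I_r).

(** The action of [f] on [Omodule], read as a map of [V i] so that it can carry a [k]-linear
    structure. *)
Definition diag_comp i f (v : V i) : V i := Ohat_red f (dsum_inj v) i.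

Lemma Ohat_redZ f (c : kr) (x : D) : Ohat_red f (c *: x) = c *: Ohat_red f x.
Proof. by have := Ohat_red_linear f c x 0; rewrite Ohat_red0 !addr0. Qed.

(** The reduction commutes with the standard idempotents of [k^r], hence is block diagonal. *)
Lemma Ohat_red_diag_comp f (x : D) i : Ohat_red f x i = diag_comp f (x i).
Proof.
rewrite /diag_comp -dsum_idem Ohat_redZ dsum_idem; exact/esym/dsum_injK.
Qed.

Lemma dsum_injZ i (c : k) (v : V i) :
  dsum_inj (c *: v) = ([ffun=> c] : kr) *: dsum_inj v.
Proof.
apply: dsum_ext => j; rewrite -[RHS]/(_ j *: _ j) ffunE /dsum_inj.
have [<-|ij] := eqVneq i j; first by rewrite !dfwithin.
by rewrite !dfwithout // scaler0.
Qed.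

Lemma diag_comp_linear i f : linear (@diag_comp i f).
Proof.
move=> c u v; rewrite /diag_comp dsum_injD dsum_injZ (Ohat_red_linear f).
by rewrite -[LHS]/((_ : kr) i *: _ i + _ i) ffunE.
Qed.

HB.instance Definition _ i f :=
  GRing.isLinear.Build k (V i) (V i) *:%R (@diag_comp i f) (@diag_comp_linear i f).

Lemma diag_compB i f g (v : V i) : diag_comp (f - g) v = diag_comp f v - diag_comp g v.
Proof.
rewrite /diag_comp Ohat_redD -[LHS]/(_ i + _ i); congr (_ + _).
apply: (addrI (Ohat_red g (dsum_inj v) i)); rewrite subrr.
rewrite -[LHS]/((Ohat_red g (dsum_inj v) + Ohat_red (- g) (dsum_inj v)) i).
by rewrite -Ohat_redD subrr /Ohat_red /= hat_red0.
Qed.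

Lemma diag_compD i f g (v : V i) : diag_comp (f + g) v = diag_comp f v + diag_comp g v.
Proof. by rewrite /diag_comp Ohat_redD. Qed.

Lemma diag_compM i f g (v : V i) : diag_comp (f * g) v = diag_comp g (diag_comp f v).
Proof. by rewrite /diag_comp Ohat_redM Ohat_red_diag_comp. Qed.

Lemma diag_comp1 i (v : V i) : diag_comp (1 : O) v = v.
Proof. by rewrite /diag_comp Ohat_red1 dsum_injK. Qed.

Definition dsum_map (a : forall i, {linear V i -> V i}) (x : D) : D :=
  fun i => a i (x i).

Fact dsum_map_linear a : linear (dsum_map a).
Proof. by move=> c x y; apply: dsum_ext => i; exact: linearP. Qed.

HB.instance Definition _ a :=
  GRing.isLinear.Build kr D D *:%R (dsum_map a) (dsum_map_linear a).

Definition Ohat_diag a : O := Ohat_map H (dsum_map a).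

Lemma diag_comp_Ohat_diag a i (v : V i) : diag_comp (Ohat_diag a) v = a i v.
Proof. by rewrite /diag_comp Ohat_red_map /= /dsum_map dsum_injK. Qed.

(** For [a = idfun] this lifts the projection of the direct sum onto [V i]. *)
Definition Ohat_single i (a : {linear V i -> V i}) : O :=
  Ohat_diag (dfwith (fun j => \0 : {linear V j -> V j}) i a).

Lemma diag_comp_single i (a : {linear V i -> V i}) v : diag_comp (Ohat_single a) v = a v.
Proof. by rewrite diag_comp_Ohat_diag dfwithin. Qed.

Lemma diag_comp_single_neq i j (a : {linear V i -> V i}) (v : V j) :
  i != j -> diag_comp (Ohat_single a) v = 0.
Proof. by move=> ij; rewrite diag_comp_Ohat_diag dfwithout. Qed.

(** Here [1 - f] has zero reduction, so the geometric series gives a right inverse of [f], which [K]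
    absorbs. *)
Lemma ideal_unit_of_comp (K : set O) f :
  two_sided_ideal K -> K f -> (forall i, @diag_comp i f =1 id) -> K 1.
Proof.
move=> [_ _ Kr] Kf fid; have [|g fg] := @Ohat_geometric _ _ H D (1 - f).
  by move=> x; apply: dsum_ext => i; rewrite Ohat_red_diag_comp diag_compB diag_comp1 fid subrr.
by rewrite -fg opprB addrC subrK; exact: Kr.
Qed.

Hypothesis V_neq0 : forall i, exists v : V i, v != 0.

Lemma Omodule_simple i : simple_module (Omodule H V i).
Proof.
split; first exact: V_neq0.
move=> N [N0 Nl]; have [N1|/existsNP[w /not_implyP[Nw /eqP w0]]] :=
    pselect (forall v, v \in N -> v = 0).
  left=> v; rewrite [RHS]inE; apply/idP/eqP => [/N1//|->]; exact: N0.
right=> u; rewrite [RHS]inE.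
have [a [_ aw]] := linear_separation (u : V i) (lspan_set0 w0).
have := Nl (Ohat_single a : O^c) w 0 Nw N0.
by rewrite addr0 -[_ *: _]/(diag_comp (Ohat_single a) w) diag_comp_single aw.
Qed.

Hypothesis V_countable : forall i, has_countable_basis (V i).

Definition max_ideal i : set O := [set f | negligible (@diag_comp i f)].

Lemma max_ideal_ideal i : two_sided_ideal (max_ideal i).
Proof.
split.
- split=> [|f g Jf Jg].
    rewrite /max_ideal /=; suff -> : @diag_comp i 0 = fun=> 0 by exact: negligible0.
    by apply/funext => v; rewrite -(subrr 0) diag_compB subrr.
  rewrite /max_ideal /=; suff -> : @diag_comp i (f - g) = fun v => diag_comp f v - diag_comp g v.
    exact: negligibleB.
  by apply/funext => v; exact: diag_compB.
- move=> f g Jg; rewrite /max_ideal /=.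
  have -> : @diag_comp i (f * g) = idfun \o @diag_comp i g \o @diag_comp i f.
    by apply/funext => v; exact: diag_compM.
  exact: negligible_comp.
- move=> f g Jg; rewrite /max_ideal /=.
  have -> : @diag_comp i (g * f) = @diag_comp i f \o @diag_comp i g \o idfun.
    by apply/funext => v; exact: diag_compM.
  exact: negligible_comp.
Qed.

Lemma negligible_id i : ~ negligible (id : V i -> V i).
Proof. by have [v v0] := V_neq0 i; exact: not_negligible_id v0. Qed.

Lemma max_ideal_neq i j : max_ideal i (Ohat_single (idfun : {linear V j -> V j})) -> i != j.
Proof.
move=> Jij; apply/eqP => ij; subst j; apply: (@negligible_id i).
by have := Jij; rewrite /max_ideal /= (funext (diag_comp_single _)).
Qed.

Lemma max_ideal_single i j : j != i ->
  max_ideal i (Ohat_single (idfun : {linear V j -> V j})).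
Proof.
move=> ji; rewrite /max_ideal /=.
have -> : @diag_comp i (Ohat_single (idfun : {linear V j -> V j})) = fun=> 0.
  by apply/funext => v; exact: diag_comp_single_neq.
exact: negligible0.
Qed.

(** The lift of the [j]-th projection lies in [max_ideal i] exactly when [i] differs from [j]. *)
Lemma max_ideal_inj : injective max_ideal.
Proof.
move=> i j ij; apply/eqP; apply: contraT => /max_ideal_single; rewrite -ij.
by move=> /max_ideal_neq/eqP.
Qed.

(** Every linear endomorphism of [V i] is a component of some [Ohat_single], so the [i]-th
    components of [K] are closed under composition on both sides. One of them is not negligible. *)
Lemma ideal_comp_id (K : set O) i :
  two_sided_ideal K -> ~ K `<=` max_ideal i ->
  exists2 g, K g & @diag_comp i g =1 id.
Proof.
move=> idK /existsNP[f /not_implyP[Kf Jf]]; have [_ Kl Kr] := idK.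
pose Ki : set {linear V i -> V i} := [set h | exists2 f, K f & @diag_comp i f =1 h].
have [e eV] := countable_basis_span (V_countable i).
have [||||h [g Kg gh] h1] := @ideal_not_negligible _ _ Ki _ _ e (@diag_comp i f) eV.
- move=> a b [g Kg ga] [h Kh hb]; exists (g + h); first exact: idealD.
  by move=> v; rewrite diag_compD ga hb.
- move=> a h b [g Kg gh]; exists (Ohat_single a * g * Ohat_single b).
    by apply: Kr; exact: Kl.
  by move=> v; rewrite !diag_compM !diag_comp_single gh.
- by exists f.
- exact: Jf.
- by exists g => // v; rewrite gh h1.
Qed.

Lemma max_ideal_maximal i : maximal_ideal (max_ideal i).
Proof.
split; first exact: max_ideal_ideal.
  move=> JT; apply: (@negligible_id i); have : max_ideal i 1 by rewrite JT.
  by rewrite /max_ideal /= (funext (@diag_comp1 i)).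
move=> K idK JK; have [KJ|KJ] := pselect (K `<=` max_ideal i).
  by left; apply/seteqP.
right; have [g Kg g1] := ideal_comp_id idK KJ; apply/seteqP; split=> // f _.
have [_ _ Kr] := idK; rewrite -[f]mul1r; apply: Kr.
(* The [i]-th component of [1 - g] is zero, so [1 - g] and [g] both lie in [K], and so does 1. *)
have K1g : K (1 - g).
  apply: JK; rewrite /max_ideal /=.
  have -> : @diag_comp i (1 - g) = fun=> 0.
    by apply/funext => v; rewrite diag_compB diag_comp1 g1 subrr.
  exact: negligible0.
by rewrite -[1](subrK g); exact: idealD.
Qed.

Lemma maximal_idealP (J : set O) : maximal_ideal J -> exists i, J = max_ideal i.
Proof.
move=> [idJ JT maxJ]; apply: contrapT => /forallNP nJ.
have nsub i : ~ J `<=` max_ideal i.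
  move=> /(maxJ _ (max_ideal_ideal i)) [/esym/nJ//|].
  by have [_ + _] := max_ideal_maximal i.
have /choice[g gP] i : exists g, J g /\ @diag_comp i g =1 id.
  by have [g] := ideal_comp_id idJ (@nsub i); exists g.
have [[J0 _] _ Jr] := idJ.
(* Cutting each [g i] down to its own block makes every component of the sum the identity. *)
pose G := \sum_i g i * Ohat_single (idfun : {linear V i -> V i}).
have JG : J G.
  rewrite /G; elim/big_ind: _ => // [x y Jx Jy|i _]; first exact: idealD.
  by apply: Jr; have [] := gP i.
have G1 : J 1.
  apply: (ideal_unit_of_comp idJ JG) => i v.
  have compS : {morph (fun f : O => diag_comp f v) : f h / f + h}.
    by move=> f h; exact: diag_compD.
  rewrite /G (big_morph _ compS (morphD0 compS)) (bigD1 i) //= big1 => [|j ji].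
    by rewrite addr0 diag_compM diag_comp_single; have [_ ->] := gP i.
  by rewrite diag_compM diag_comp_single_neq.
by apply: JT; apply/seteqP; split=> // f _; rewrite -[f]mul1r; exact: Jr.
Qed.

Lemma Ohat_pointed : pointed O r.
Proof.
rewrite /pointed.
have -> : [set J : set O | maximal_ideal J] = max_ideal @` [set: 'I_r].
  apply/seteqP; split=> [J /maximal_idealP[i ->]|_ [i _ <-]].
    by exists i.
  exact: max_ideal_maximal.
apply: card_eq_trans (inj_card_eq (in2W max_ideal_inj)) _.
have -> : `I_r = [set val i | i in [set: 'I_r]].
  by apply/seteqP; split=> [n ltnr|_ [i _ <-] /=]; [exists (Ordinal ltnr) | ].
by rewrite card_eq_sym; apply: inj_card_eq => i j _ _; exact: val_inj.
Qed.

End DiagonalComponents.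

Theorem mainTheorem2 (k : fieldType) (r : nat) (Hhat : augmentedAlgebra k r)
    (A : algType k) (M : 'I_r -> lmodType A^c)
    (rhoA : {rmorphism A -> Ohat Hhat (dsum (fun i => kres (M i)))}) :
  (1 <= r)%N ->
  aug_complete Hhat ->
  (forall i, simple_module (M i)) ->
  (forall i, has_countable_basis (kres (M i))) ->
  (forall (c : k) (a : A), rhoA (c *: a) = c *: rhoA a) ->
  pointed (Ohat Hhat (dsum (fun i => kres (M i)))) r /\
  forall i, simple_module (Omodule Hhat (fun i => kres (M i)) i).
Proof.
move=> _ _ simpleM countableM _.
(* A nonzero vector keeps the identity of [M i] from being negligible, so each [max_ideal i] is
   proper. *)
have M_neq0 i : exists v : kres (M i), v != 0 by have [] := simpleM i.
by split; [exact: Ohat_pointed | exact: Omodule_simple].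
Qed.
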